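(* There exists a finite simple connected graph $G$ with at least one edge such that every vertex of $G$ belongs to a minimum-sized connected vertex cover of $G$, but $ecvc(G)\neq cvc(G)$.
   Context: A vertex cover of a graph $G$ is a set of vertices meeting every edge; a connected vertex cover is a vertex cover that induces a connected subgraph. $cvc(G)$ is the minimum size of a connected vertex cover of $G$, and a minimum-sized connected vertex cover is one of size $cvc(G)$. Eternal Connected Vertex Cover game with $k$ guards on a finite simple connected graph $G$ with at least one edge: the defender first chooses a set of $k$ vertices and places one guard on each; this set must be a connected vertex cover. In each round the attacker attacks an edge. The defender responds by moving guards simultaneously: each guard stays put or moves to a neighbouring vertex, at least one guard must move across the attacked edge (from one endpoint to the other; guards on both endpoints may exchange positions), and after the movement at most one guard occupies each vertex. The set of occupied vertices must be a connected vertex cover after every response; otherwise (or if no legal response exists) the attacker wins. The defender wins if every attack of the infinite sequence is defended. $ecvc(G)$ is the least $k$ such that the defender with $k$ guards can defend every infinite sequence of attacks. *)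

(* Defs.v *)
From HB Require Import structures.
From mathcomp Require Import all_boot.
From mathcomp Require Import boolp.

Set Implicit Arguments.
Unset Strict Implicit.
Unset Printing Implicit Defensive.

Definition induced (T : finType) (e : rel T) (S : {set T}) : rel T :=
  [rel x y | [&& x \in S, y \in S & e x y]].

(* Holds vacuously for [set0]; this is harmless below, since every graph
   considered has an edge and so [set0] is never a vertex cover. *)
Definition induces_connected (T : finType) (e : rel T) (S : {set T}) : bool :=
  [forall x in S, forall y in S, connect (induced e S) x y].

Record cgraph := CGraph {
  vertex :> finType;
  adj : rel vertex;
  adj_sym : symmetric adj;
  adj_irrefl : irreflexive adj;
  adj_connected : induces_connected adj [set: vertex];
  adj_edge : exists x y, adj x y
}.
Arguments adj {G} : rename.

Definition edges (G : cgraph) : {set {set G}} :=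
  [set [set p.1; p.2] | p : G * G & adj p.1 p.2].

Definition vertex_cover (G : cgraph) (S : {set G}) : bool :=
  [forall A in edges G, A :&: S != set0].

Definition connected_vertex_cover (G : cgraph) (S : {set G}) : bool :=
  vertex_cover S && induces_connected adj S.

Lemma connected_vertex_coverT (G : cgraph) :
  connected_vertex_cover [set: G].
Proof.
rewrite /connected_vertex_cover adj_connected andbT.
apply/forall_inP => A /imsetP[p _ ->]; rewrite setIT.
by apply/set0Pn; exists p.1; rewrite !inE eqxx.
Qed.

Lemma ex_connected_vertex_cover (G : cgraph) :
  exists k, [exists S : {set G}, connected_vertex_cover S && (#|S| == k)].
Proof.
exists #|[set: G]|; apply/existsP; exists [set: G].
by rewrite connected_vertex_coverT eqxx.
Qed.

Definition cvc (G : cgraph) : nat := ex_minn (ex_connected_vertex_cover G).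

(* [g i] is the vertex occupied by guard [i]. *)
Definition configuration (G : cgraph) (k : nat) := {ffun 'I_k -> G}.

Definition occupied (G : cgraph) (k : nat) (g : configuration G k) : {set G} :=
  [set g i | i : 'I_k].

(* Injectivity: at most one guard on each vertex. *)
Definition legal_configuration (G : cgraph) (k : nat)
    (g : configuration G k) : Prop :=
  injective g /\ connected_vertex_cover (occupied g).

(* Since an edge [A] has two elements, [[set g i; g' i] = A] says that guard
   [i] crosses [A], in one of the two directions. *)
Definition legal_response (G : cgraph) (k : nat) (g : configuration G k)
    (A : {set G}) (g' : configuration G k) : Prop :=
  [/\ forall i, g' i = g i \/ adj (g i) (g' i),
      exists i, [set g i; g' i] = A
    & legal_configuration g'].

(* A strategy maps the list of the attacks made so far, oldest first, to the
   configuration reached after the response to the last of them; its value at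
   [[::]] is the initial placement. *)
Definition strategy (G : cgraph) (k : nat) := seq {set G} -> configuration G k.

Definition winning (G : cgraph) (k : nat) (s : strategy G k) : Prop :=
  legal_configuration (s [::]) /\
  forall a : nat -> {set G}, (forall n, a n \in edges G) ->
  forall n, legal_response (s (mkseq a n)) (a n) (s (mkseq a n.+1)).

Definition defends (G : cgraph) (k : nat) : Prop :=
  exists s : strategy G k, winning s.

(* With a guard on every vertex, the guards on the two ends of the attacked
   edge exchange their positions. *)
Lemma defends_card (G : cgraph) : defends G #|G|.
Proof.
pose step (g : configuration G #|G|) (A : {set G}) : configuration G #|G| :=
  if [pick p : G * G | adj p.1 p.2 && (A == [set p.1; p.2])] is Some p
  then [ffun i => if g i == p.1 then p.2 else
                  if g i == p.2 then p.1 else g i] else g.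
have full (g : configuration G #|G|) : injective g -> occupied g = [set: G].
  move=> ig; apply/eqP; rewrite eqEcard subsetT /= cardsT.
  by rewrite /occupied card_imset // card_ord.
have legal (g : configuration G #|G|) : injective g -> legal_configuration g.
  by move=> ig; split=> //; rewrite full // connected_vertex_coverT.
have step_inj (g : configuration G #|G|) A : injective g -> injective (step g A).
  move=> ig; rewrite /step; case: pickP => [p _|_] //.
  move=> i j; rewrite !ffunE => h; apply: ig; move: h.
  by do 4?[case: eqP => //]; congruence.
pose s0 : configuration G #|G| := [ffun i => enum_val i].
have s0_inj : injective s0.
  by move=> i j; rewrite !ffunE => /enum_val_inj.
have s_inj h : injective (foldl step s0 h).
  elim/last_ind: h => [|h A ih] //; rewrite foldl_rcons; exact: step_inj.
exists (foldl step s0); split; first exact: legal.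
move=> a ha n; rewrite mkseqS foldl_rcons.
have ig := s_inj (mkseq a n); move: (foldl step s0 _) ig => g ig.
split; last by apply/legal/step_inj.
- move=> i; rewrite /step; case: pickP => [p /andP[hp _]|_]; last by left.
  rewrite ffunE; case: eqP => [->|_]; first by right.
  by case: eqP => [->|_]; [right; rewrite adj_sym | left].
- rewrite /step; case: pickP => [p /andP[hp /eqP->]|no].
    have : p.1 \in occupied g by rewrite full.
    by case/imsetP=> i _ e; exists i; rewrite ffunE -e eqxx.
  have /imsetP[p] := ha n; rewrite inE => hp e.
  by move: (no p); rewrite hp e eqxx.
Qed.

Lemma ex_defends (G : cgraph) : exists k, `[< defends G k >].
Proof. by exists #|G|; apply/asboolP/defends_card. Qed.

Definition ecvc (G : cgraph) : nat := ex_minn (ex_defends G).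

(* Main.v *)
Require Import Defs.
From HB Require Import structures.
From mathcomp Require Import all_boot.
From mathcomp Require Import boolp.
From mathcomp Require Import zify.

(** The witness has 20 vertices, in four cells indexed by a side [s] and a level
    [k].  A cell consists of a hub, two leaves, an inner vertex and a gate.  A
    hub and its two leaves form a triangle, whose only exit is the hub; a gate
    is joined to the hubs of its level on both sides, and these are the only
    edges between the two sides; an inner vertex is joined to hubs and gates of
    its own side only.

    A connected vertex cover contains every hub ([hub_in_cover]): otherwise the
    leaf that covers the leaf-leaf edge would be cut off.  It also contains a
    leaf of each cell, and the inner vertex or the gate of each cell, because
    these two are adjacent.  This gives three vertices per cell, hence
    [cvc = 12].  In a cover of size 12 each cell contains exactly one of its
    inner vertex and its gate, and connectivity then leaves only two
    possibilities ([min_cover_shape]): both inner vertices on one side and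
    both gates on the other.  Both possibilities occur ([min_cover]), and with
    a suitable choice of leaves the two covers contain all the vertices.

    Twelve guards lose at the first attack.  Let [s] be the side with occupied
    inner vertices, and attack an edge between a hub of the other side and a
    gate of side [s].  The answer must reach the other kind of cover.  A guard
    leaving side [s] would leave from a gate of side [s], none of which is
    occupied before the move, or enter a gate of the other side, none of which
    is occupied after it.  So the six guards of side [s] stay there and are
    joined by the guard that crosses the attacked edge, although the new cover
    has only six vertices on side [s]. *)

Set Implicit Arguments.
Unset Strict Implicit.
Unset Printing Implicit Defensive.

(** * Connected vertex covers of arbitrary graphs *)

Lemma vertex_coverP (G : cgraph) (S : {set G}) :
  reflect (forall x y : G, adj x y -> (x \in S) || (y \in S)) (vertex_cover S).
Proof.
apply: (iffP forall_inP) => [cover x y xy | cover A /imsetP[p]].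
  have /cover/set0Pn[z] : [set x; y] \in edges G.
    by apply/imsetP; exists (x, y); rewrite ?inE.
  by rewrite !inE => /andP[/orP[]/eqP->->]; rewrite ?orbT.
rewrite inE => /cover/orP[] pS ->; apply/set0Pn; [exists p.1|exists p.2];
  by rewrite !inE pS eqxx ?orbT.
Qed.

(** The form in which connectivity refutes a cover: a property that passes
    along the edges inside [S] cannot separate [S]. *)
Lemma induces_connected_invariant (T : finType) (e : rel T) (S : {set T})
    (P : pred T) :
  induces_connected e S ->
  (forall u v, u \in S -> v \in S -> e u v -> P u -> P v) ->
  forall x y, x \in S -> y \in S -> P x -> P y.
Proof.
move=> conn inv x y xS yS.
have /connectP[p] := forall_inP (forall_inP conn x xS) y yS.
elim: p x {xS} => [|z p IHp] x /=; first by move=> _ ->.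
by case/andP=> /and3P[xS zS xz] /IHp IH /IH{}IH /(inv _ _ xS zS xz)/IH.
Qed.

(** Following [parent], which [h] shows to end at [r], draws a spanning tree of
    [S] rooted at [r]. *)
Lemma induces_connected_descent (T : finType) (e : rel T) (S : {set T})
    (r : T) (h : T -> nat) (parent : T -> T) :
  symmetric e ->
  (forall u, u \in S -> u != r ->
     [/\ parent u \in S, e u (parent u) & h (parent u) < h u]) ->
  induces_connected e S.
Proof.
move=> sym_e down.
have sym : connect_sym (induced e S).
  by apply: sym_connect_sym => x y; rewrite /induced /= sym_e andbCA.
have to_root u : u \in S -> connect (induced e S) u r.
  have [n] := ubnP (h u); elim: n u => // n IHn u lt_hu uS.
  have [->|/(down u uS)[pS up lt_h]] := eqVneq u r; first exact: connect0.
  apply: connect_trans (IHn _ (leq_trans lt_h lt_hu) pS).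
  by apply: connect1; apply/and3P.
apply/forall_inP=> x xS; apply/forall_inP=> y yS.
by apply: connect_trans (to_root x xS) _; rewrite sym to_root.
Qed.

Lemma cvc_le (G : cgraph) (S : {set G}) :
  connected_vertex_cover S -> cvc G <= #|S|.
Proof.
rewrite /cvc; case: ex_minnP => m _ min_m cS.
by apply: min_m; apply/existsP; exists S; rewrite cS eqxx.
Qed.

Lemma cvc_attained (G : cgraph) :
  exists2 S : {set G}, connected_vertex_cover S & #|S| = cvc G.
Proof.
rewrite /cvc; case: ex_minnP => m /existsP[S /andP[cS /eqP eqm]] _.
by exists S.
Qed.

Lemma ecvc_defends (G : cgraph) : defends G (ecvc G).
Proof. by rewrite /ecvc; case: ex_minnP => m /asboolP. Qed.

(** * The witness graph *)

Inductive kind := Hub | Leaf of bool | Inner | Gate.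

Definition kind_code (c : kind) : option (bool + bool) :=
  match c with
  | Hub => None | Leaf b => Some (inl b)
  | Inner => Some (inr true) | Gate => Some (inr false)
  end.
Definition kind_decode (o : option (bool + bool)) : kind :=
  match o with
  | None => Hub | Some (inl b) => Leaf b
  | Some (inr true) => Inner | Some (inr false) => Gate
  end.
Lemma kind_codeK : cancel kind_code kind_decode. Proof. by case. Qed.
HB.instance Definition _ := Countable.copy kind (can_type kind_codeK).

Lemma kind_enumP :
  Finite.axiom [:: Hub; Leaf true; Leaf false; Inner; Gate].
Proof. by case=> [|[]||]. Qed.
HB.instance Definition _ := isFinite.Build kind kind_enumP.

Lemma sum_kind (F : kind -> nat) :
  \sum_c F c =
  F Hub + (F (Leaf true) + F (Leaf false)) + (F Inner + F Gate).
Proof. by rewrite -big_enum enumT !unlock /= addn0 !addnA. Qed.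

(** Triples of a side, a level and a kind. *)
Definition site : finType := (bool * bool * kind)%type.

Definition side (u : site) : bool := u.1.1.

(** Each edge is listed in one direction only.  Level [true] is the upper one.
    The edge between a lower gate and the upper inner vertex of its side makes
    the upper inner vertex necessary as soon as the lower gate is absent; the
    upper inner vertex misses the upper hub, so that it cannot replace the lower
    one in connecting the two hubs of its side. *)
Definition arc (u v : site) : bool :=
  let: (s, k, c) := u in let: (s', k', c') := v in
  match c, c' with
  | Leaf b, Leaf b' => [&& s == s', k == k' & b != b']
  | Leaf _, Hub => (s == s') && (k == k')
  | Gate, Hub => k == k'
  | Gate, Inner => (s == s') && (k ==> k')
  | Inner, Hub => (s == s') && ~~ (k && k')
  | _, _ => false
  end.

Definition link (u v : site) : bool := arc u v || arc v u.
Arguments link u v /.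

Lemma link_sym : symmetric link.
Proof. by move=> u v; apply: orbC. Qed.

Lemma link_irrefl : irreflexive link.
Proof. by move=> [[s k] [|b||]] //=; rewrite !eqxx. Qed.

(** The two minimum covers used, one for each [s].  Their leaves are chosen
    complementary, so that together they contain every vertex. *)
Definition min_cover (s : bool) : {set site} :=
  [set u : site | match u.2 with
     | Hub => true | Leaf b => b == s
     | Inner => side u == s | Gate => side u != s
     end].

(** A tree rooted at the lower hub of side [s]: the inner vertices of side [s]
    join its two hubs, the gates of the other side lead to the hubs there. *)
Definition parent (s : bool) (u : site) : site :=
  let: (s', k, c) := u in
  match c with
  | Hub => if s' == s then (s, false, Inner) else (s', k, Gate)
  | Leaf _ => (s', k, Hub)
  | Inner => (s', false, Hub)
  | Gate => (s, k, Hub)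
  end.

Definition height (s : bool) (u : site) : nat :=
  let: (s', k, c) := u in
  match c with
  | Hub => if s' == s then k.*2 else 4
  | Leaf _ => 5
  | Inner => if s' == s then 1 else 5
  | Gate => 3
  end.

(** The tree of [parent s] has all its internal vertices in [min_cover s], so
    it also spans every larger set; for [setT] this is the connectivity of the
    graph. *)
Lemma connected_above_min_cover (s : bool) (S : {set site}) :
  min_cover s \subset S -> induces_connected link S.
Proof.
move=> /subsetP sub.
apply: (@induces_connected_descent _ _ _ (s, false, Hub) (height s) (parent s)).
  exact: link_sym.
move=> [[s' k] c] uS ne; split.
- case: c uS ne => [|b||] uS ne /=; try by apply: sub; rewrite inE.
  case: eqP => [_|/eqP ne_s]; apply: sub; rewrite inE /=; exact.
- by case: c ne {uS} => [|b||]; case: s' k s {sub} => [] [] [].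
- by case: c ne {uS} => [|b||]; case: s' k s {sub} => [] [] [].
Qed.

Lemma link_connected : induces_connected link [set: site].
Proof. exact: (connected_above_min_cover (subsetT (min_cover true))). Qed.

Lemma link_edge : exists x y, link x y.
Proof. by exists (true, true, Leaf true), (true, true, Hub). Qed.

Definition witness : cgraph :=
  CGraph link_sym link_irrefl link_connected link_edge.

Lemma min_cover_connected_vertex_cover (s : bool) :
  @connected_vertex_cover witness (min_cover s).
Proof.
apply/andP; split; last exact: connected_above_min_cover (subxx _).
apply/vertex_coverP => -[[s1 k1] c1] [[s2 k2] c2].
rewrite /= !inE /side /=.
by case: c1 => [|b1||]; case: c2 => [|b2||]; rewrite ?orbT //=;
   case: s1 s2 s k1 k2 => [] [] [] [] []; rewrite //=; case: b1 b2 => [] [].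
Qed.

(** * Counting by cells *)

Definition cell_card (S : {set site}) (s k : bool) : nat :=
  \sum_c ((s, k, c) \in S).

Lemma card_cells (S : {set site}) : #|S| = \sum_s \sum_k cell_card S s k.
Proof.
rewrite -sum1_card big_mkcond /= pair_bigA /= pair_bigA /=.
by apply: eq_bigr => -[[s k] c] _; case: ifP.
Qed.

Lemma card_side (S : {set site}) (s : bool) :
  #|[set u in S | side u == s]| = \sum_k cell_card S s k.
Proof.
rewrite card_cells (bigD1 s) //= [X in _ + X]big1 => [|s' ne_s].
  rewrite addn0; apply: eq_bigr => k _; apply: eq_bigr => c _.
  by rewrite inE eqxx andbT.
rewrite big1 // => k _; rewrite /cell_card big1 // => c _.
by rewrite inE /side /= (negPf ne_s) andbF.
Qed.

Lemma card_min_cover (s : bool) : #|min_cover s| = 12.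
Proof.
rewrite card_cells !big_bool /cell_card !sum_kind !inE /side /=.
by case: s.
Qed.

(** * The minimum connected vertex covers *)

Section ConnectedVertexCover.

Variable S : {set site}.
Hypothesis cS : @connected_vertex_cover witness S.

Let cover (x y : site) : link x y -> (x \in S) || (y \in S).
Proof. by case/andP: cS => /vertex_coverP/(_ x y). Qed.

Let invariant (P : pred site) := @induces_connected_invariant site link S P
  (proj2 (andP cS)).

Lemma leaf_in_cover (s k : bool) : exists b, (s, k, Leaf b) \in S.
Proof.
have: link (s, k, Leaf true) (s, k, Leaf false) by rewrite /= !eqxx.
by move/cover/orP=> [h|h]; [exists true|exists false].
Qed.

(** Without the hub, the leaves of its cell would be separated from those of
    another cell. *)
Lemma hub_in_cover (s k : bool) : (s, k, Hub) \in S.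
Proof.
apply: contraT => hubN.
have [b bS] := leaf_in_cover s k.
have [b' bS'] := leaf_in_cover (~~ s) k.
pose P (u : site) := (u.1 == (s, k)) && (if u.2 is Leaf _ then true else false).
have : P (~~ s, k, Leaf b').
  apply: (invariant (P := P)) bS bS' _; last by rewrite /P /= eqxx.
  move=> [[s1 k1] c1] [[s2 k2] c2] _ vS uv; rewrite /P /= => /andP[/eqP[es ek]].
  move: uv; rewrite {s1}es {k1}ek; case: c1 => // b1.
  case: c2 vS => [|b2||] vS //=; rewrite ?orbF.
    by case/andP=> /eqP es /eqP ek; rewrite -es -ek (negPf hubN) in vS.
  by case/orP=> /and3P[/eqP-> /eqP->]; rewrite eqxx.
by rewrite /P /= andbT; case: (s).
Qed.

Lemma inner_or_gate_in_cover (s k : bool) :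
  ((s, k, Inner) \in S) || ((s, k, Gate) \in S).
Proof. by apply: cover; rewrite /= eqxx implybb. Qed.

Lemma cell_card_ge3 (s k : bool) : 3 <= cell_card S s k.
Proof.
rewrite /cell_card sum_kind hub_in_cover.
have [b bS] := leaf_in_cover s k; have := inner_or_gate_in_cover s k.
by case: b bS => ->; do 3?case: (_ \in S).
Qed.

Lemma cover_card_ge12 : 12 <= #|S|.
Proof.
rewrite card_cells !big_bool.
by rewrite (@leq_add 6 6) // (@leq_add 3 3) // cell_card_ge3.
Qed.

Hypothesis S12 : #|S| = 12.

Lemma cell_card_min (s k : bool) : cell_card S s k = 3.
Proof.
move: S12; rewrite card_cells !big_bool /=.
have := cell_card_ge3 true true; have := cell_card_ge3 true false.
have := cell_card_ge3 false true; have := cell_card_ge3 false false.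
by case: s k => [] []; move: (cell_card S) => f; lia.
Qed.

Lemma side_card_min (s : bool) : #|[set u in S | side u == s]| = 6.
Proof. by rewrite card_side big_bool !cell_card_min. Qed.

Lemma gate_in_min (s k : bool) :
  ((s, k, Gate) \in S) = ((s, k, Inner) \notin S).
Proof.
have := cell_card_min s k; rewrite /cell_card sum_kind hub_in_cover.
have [b bS] := leaf_in_cover s k; have := inner_or_gate_in_cover s k.
by case: b bS => ->; do 3?case: (_ \in S).
Qed.

(** The lower inner vertex excludes the lower gate, and the edge from that gate
    to the upper inner vertex has to be covered. *)
Lemma inner_true_of_false (s : bool) :
  (s, false, Inner) \in S -> (s, true, Inner) \in S.
Proof.
have : link (s, false, Gate) (s, true, Inner) by rewrite /= eqxx.
by case/cover/orP=> [|->//]; rewrite gate_in_min => /negPf->.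
Qed.

(** An edge that leaves the set of upper hubs, leaves and gates leads to a lower
    inner vertex, or from a gate to the inner vertex of its own cell; a cover of
    size 12 does not contain both ends of the latter. *)
Lemma some_inner : exists s, (s, false, Inner) \in S.
Proof.
have [h|] := boolP [exists s, (s, false, Inner) \in S]; first exact/existsP.
rewrite negb_exists => /forallP noI.
pose P (u : site) := u.1.2 && (if u.2 is Inner then false else true).
suff : P (true, false, Hub) by [].
apply: (invariant (P := P)) (hub_in_cover true true) _ _ => //.
  move=> [[s1 k1] c1] [[s2 k2] c2] uS vS uv; rewrite /P /= => /andP[k1T].
  move: uv uS vS; rewrite {k1}k1T.
  case: c1 => [|b1||] //; case: c2 => [|b2||] //=; case: k2 => //=;
    rewrite ?andbF ?orbF ?orbT ?andbT //.
  + by move=> _ _; rewrite (negPf (noI _)).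
  + by move=> /eqP <-; rewrite gate_in_min => /negPf->.
exact: hub_in_cover.
Qed.

(** One side has its lower inner vertex, hence both.  On the other side, the
    lower one would bring the upper one, exclude all gates and so separate the
    two sides; the upper one alone would exclude both upper gates and so isolate
    the triangle of the upper hub. *)
Lemma min_cover_shape :
  exists s, forall k, ((s, k, Inner) \in S) && ((~~ s, k, Gate) \in S).
Proof.
have [s s0] := some_inner; have s1 := inner_true_of_false s0; exists s.
suff [n0 n1] : (~~ s, false, Inner) \notin S /\ (~~ s, true, Inner) \notin S.
  by case; rewrite ?s0 ?s1 gate_in_min ?n0 ?n1.
have n0 : (~~ s, false, Inner) \notin S.
  apply/negP=> t0; have t1 := inner_true_of_false t0.
  have noG s' k : (s', k, Gate) \notin S.
    rewrite gate_in_min negbK; have [->|ne_s] := eqVneq s' s; first by case: k.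
    have -> : s' = ~~ s by case: s' (s) ne_s => [] [].
    by case: k.
  (* Without gates, no edge inside [S] joins the two sides. *)
  pose P (u : site) := side u == s.
  suff : P (~~ s, false, Hub) by rewrite /P /side /=; case: (s).
  apply: (invariant (P := P)) (hub_in_cover s false) (hub_in_cover _ _) _ => //;
    last by rewrite /P.
  move=> [[s3 k1] c1] [[s2 k2] c2] uS vS uv; rewrite /P /side /= => /eqP es.
  move: uv uS vS; rewrite {s3}es.
  case: c1 => [|b1||] //; case: c2 => [|b2||] //=;
    rewrite ?(negPf (noG _ _)) ?orbF //=.
  all: try by case/andP=> /eqP->.
  by case/orP=> /and3P[/eqP->].
split=> //; apply/negP=> t1.
pose P (u : site) :=
  (u.1 == (~~ s, true)) && (if u.2 is (Hub|Leaf _) then true else false).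
suff : P (s, false, Hub) by rewrite /P /=; case: (s).
apply: (invariant (P := P)) (hub_in_cover (~~ s) true) (hub_in_cover _ _) _ => //;
  last by rewrite /P /= eqxx.
move=> [[s3 k1] c1] [[s2 k2] c2] uS vS uv; rewrite /P /= => /andP[/eqP[es ek]].
move: uv uS vS; rewrite {s3}es {k1}ek.
case: c1 => [|b1||] //; case: c2 => [|b2||] //=; rewrite ?orbF.
- by case/andP=> /eqP-> /eqP->; rewrite eqxx.
- by case/andP=> /eqP->; rewrite andbT => /negPf->; rewrite (negPf n0).
- move=> /eqP->; rewrite gate_in_min.
  have [->|ne_s] := eqVneq s2 s; first by rewrite s1.
  have -> : s2 = ~~ s by case: s2 (s) ne_s => [] [].
  by rewrite t1.
- by case/andP=> /eqP-> /eqP->; rewrite eqxx.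
- by case/orP=> /and3P[/eqP-> /eqP->]; rewrite eqxx.
Qed.

End ConnectedVertexCover.

Lemma cvc_witness : cvc witness = 12.
Proof.
apply/eqP; rewrite eqn_leq -{1}(card_min_cover true).
rewrite cvc_le ?min_cover_connected_vertex_cover //=.
by have [S cS <-] := cvc_attained witness; apply: cover_card_ge12.
Qed.

(** * The game *)

Lemma card_guards (G : cgraph) (k : nat) (g : configuration G k) (P : pred G) :
  injective g -> #|[set i | P (g i)]| = #|[set u in occupied g | P u]|.
Proof.
move=> ig; rewrite -(card_imset _ ig); apply: eq_card => u.
rewrite inE; apply/imsetP/andP => [[i]|[/imsetP[i _ ->] Pi]].
  by rewrite inE => Pi ->; split=> //; apply: imset_f.
by exists i; rewrite ?inE.
Qed.

Lemma gate_between_sides (u v : site) :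
  link u v -> side u != side v -> u.2 = Gate \/ v.2 = Gate.
Proof.
move: u v => [[s k] c] [[s' k'] c']; rewrite /side /=.
by case: c c' => [|b||] [|b'||] //=; case: (eqVneq s s') => //= _; auto.
Qed.

(** After one attack, side [s] would hold seven of the guards but only six
    vertices of the cover. *)
Lemma witness_not_defended : ~ defends witness 12.
Proof.
case=> str [[inj0 c0] resp].
have card_occ (g : configuration witness 12) : injective g -> #|occupied g| = 12.
  by move=> ig; rewrite /occupied card_imset // card_ord.
have [s shape] := min_cover_shape c0 (card_occ _ inj0).
pose h : site := (~~ s, false, Hub); pose q : site := (s, false, Gate).
have hq : [set h; q] \in edges witness.
  by apply/imsetP; exists (h, q); rewrite ?inE.
have [moves [i0 cross] [inj1 c1]] := resp (fun=> [set h; q]) (fun=> hq) 0.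
rewrite /= in moves cross inj1 c1.
move: (str _) (str _) inj0 c0 shape moves cross inj1 c1 => g' g.
move=> ig cg shape moves cross ig' cg'.
have gate_min := gate_in_min cg (card_occ _ ig).
have gate_min' := gate_in_min cg' (card_occ _ ig').
have in_g i : g i \in occupied g by apply: imset_f.
have in_g' i : g' i \in occupied g' by apply: imset_f.
have noGate (u : site) : u \in occupied g -> side u = s -> u.2 <> Gate.
  case: u => [[s1 k] c]; rewrite /side /= => + es ec; rewrite es ec gate_min.
  by case/andP: (shape k) => ->.
(* The attacked gate is empty, so the guard that crosses comes from the hub. *)
have [g0h g0q] : g i0 = h /\ g' i0 = q.
  have g0 : g i0 = h.
    have := set21 (g i0) (g' i0); rewrite cross => /set2P[//|eq_q].
    by case: (noGate (g i0)); rewrite // eq_q.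
  split=> //; have := set22 h q; rewrite -cross => /set2P[|//].
  by rewrite g0.
have [s' shape'] := min_cover_shape cg' (card_occ _ ig').
(* The attacked gate is now occupied, which rules out the old kind of cover. *)
have es : s' = ~~ s.
  have := in_g' i0; rewrite g0q gate_min'.
  have /andP[] := shape' false.
  by case: (s') (s) => [] [] //= ->.
have noGate' (u : site) : u \in occupied g' -> side u != s -> u.2 <> Gate.
  case: u => [[s1 k] c]; rewrite /side /= => + ne_s ec.
  have -> : s1 = s' by rewrite es; case: s1 (s) ne_s => [] [].
  by rewrite ec gate_min'; case/andP: (shape' k) => ->.
have stay i : side (g i) = s -> side (g' i) = s.
  move=> si; case: (moves i) => [->//|adj_i]; apply/eqP/contraT => ne_s.
  have : side (g i) != side (g' i) by rewrite si eq_sym.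
  case/(gate_between_sides adj_i) => [/(noGate _ (in_g i) si)//|].
  by move/(noGate' _ (in_g' i) ne_s).
have : [set i | side (g i) == s] \proper [set i | side (g' i) == s].
  apply/properP; split.
    by apply/subsetP=> i; rewrite !inE => /eqP/stay->.
  by exists i0; rewrite inE ?g0q ?g0h /side /= ?eqxx //; case: (s).
move/proper_card; rewrite !(card_guards (fun u : witness => side u == s)) //.
by rewrite !side_card_min // card_occ.
Qed.

Theorem theorem1 :
  exists G : cgraph,
    (forall v : G, exists S : {set G},
       [/\ connected_vertex_cover S, #|S| = cvc G & v \in S]) /\
    ecvc G <> cvc G.
Proof.
exists witness; split=> [v|eq_cvc]; last first.
  apply: witness_not_defended; rewrite -cvc_witness -eq_cvc.
  exact: ecvc_defends.
have [s vs] : exists s, v \in min_cover s.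
  case: v => -[s k] [|b||]; [exists s|exists b|exists s|exists (~~ s)];
    by rewrite inE ?eqxx // /side /=; case: (s).
exists (min_cover s).
by rewrite min_cover_connected_vertex_cover card_min_cover cvc_witness.
Qed.
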